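(* Let $n,t,k_1,\ldots,k_{t+1}$ be positive integers with $k_1\ge k_2\ge\cdots\ge k_{t+1}\ge 2$ and $n\ge 2k_1^2k_2t$. Let $F_i\subseteq\binom{[n]}{k_i}$ for $i\in[t+1]$ be such that $$|F_i|>\binom{n}{k_i}-\binom{n-t}{k_i}-\binom{n-t-k_{3-i}}{k_i-1}+1\quad\text{for } i\in\{1,2\},$$ and $$|F_i|>\binom{n}{k_i}-\binom{n-t}{k_i}-\binom{n-t-k_{3}}{k_i-1}+1\quad\text{for } i\in[t+1]\setminus\{1,2\}.$$ Then either (i) $\{F_1,\ldots,F_{t+1}\}$ admits a rainbow matching of size $t+1$, or (ii) there exists $W\in\binom{[n]}{t}$ which is a vertex cover of $F_i$ for every $i\in[t+1]$.
   Context: $[n]=\{1,\ldots,n\}$ and $\binom{S}{j}$ is the family of $j$-element subsets of $S$. A rainbow matching of size $q$ for $\{F_1,\ldots,F_q\}$ is a choice of pairwise disjoint sets $e_i\in F_i$, $i\in[q]$. A vertex cover of a family $F$ of sets is a set meeting every member of $F$. (When $t=1$ the second condition is vacuous.) *)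

(* Defs.v *)
From mathcomp Require Import all_boot all_order all_algebra.
Set Implicit Arguments. Unset Strict Implicit. Unset Printing Implicit Defensive.
Import GRing.Theory Num.Theory.

Definition rainbow_matching (n t : nat) (F : nat -> {set {set 'I_n}}) : Prop :=
  exists e : nat -> {set 'I_n},
    (forall i, 1 <= i <= t.+1 -> e i \in F i) /\
    (forall i j, 1 <= i <= t.+1 -> 1 <= j <= t.+1 -> i != j ->
       [disjoint e i & e j]).

Definition vertex_cover (n : nat) (W : {set 'I_n}) (G : {set {set 'I_n}}) : Prop :=
  forall A, A \in G -> W :&: A != set0.

Definition bound (n t k m : nat) : int :=
  ('C(n, k))%:Z - ('C(n - t, k))%:Z - ('C(n - t - m, k.-1))%:Z + 1.

(* Main.v *)
Require Import Defs.
From mathcomp Require Import all_boot all_order all_algebra zify.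
Import GRing.Theory Num.Theory.
Set Implicit Arguments. Unset Strict Implicit. Unset Printing Implicit Defensive.

(** Induction on [t].  If every vertex has small degree in the last family, then any rainbow
    matching of the first [t] families extends greedily, and such a matching exists because each
    of these families is larger than the family of all sets meeting a fixed [(t-1)]-set.
    Otherwise set aside a vertex [v] of large degree in the last family: a rainbow matching of
    the first [t] families avoiding [v] extends, so by induction [v] together with some
    [(t-1)]-set covers the first [t] families.  If a set [A] of the last family misses this cover
    [W], then fewer than ['C(n - t - #|A|, k_i - 1)] sets meeting [W] are absent from [F_i], so
    each family is rich at all but at most one vertex of [W], and distinct vertices of [W] can
    be assigned to the families to give a matching disjoint from [A].

    The case [t = 1] is a Hilton-Milner theorem for cross-intersecting families of [a]-sets and
    [b]-sets, [b <= a].  If there is no common vertex, the size hypotheses show that every vertex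
    is missed by two sets of each family.  Call a pair heavy in a family if its degree there
    exceeds the fraction [1 / (2 a)] of the maximal possible one.  Heavy pairs of one family meet
    every set and every heavy pair of the other one; counting gives at least [b] (resp. [a])
    heavy pairs, and neither graph of heavy pairs is a star, as its leaves would all lie in the
    intersection of two distinct sets of the other family.  Two cross-intersecting graphs without
    common vertex are tiny, which leaves only [a = b = 3] with both graphs a triangle or a path,
    where the family has at most [3 n - 8] sets. *)

(** * Binomial estimates *)

(** Pascal's rule deletes [s] points one by one, and each deletion costs at most ['C(n.-1, k)]. *)
Lemma leq_bin_sub (n s k : nat) :
  'C(n, k.+1) <= 'C(n - s, k.+1) + s * 'C(n.-1, k).
Proof.
elim: s => [|s IH]; first by rewrite subn0 addn0.
apply: (leq_trans IH); case E: (n - s) => [|m].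
  by rewrite bin0n add0n (leq_trans _ (leq_addl _ _)) // leq_mul2r leqnSn orbT.
have -> : n - s.+1 = m by lia.
rewrite binS mulSn -!addnA leq_add2l leq_add2r leq_bin2l //; lia.
Qed.

(** The second Bonferroni inequality for the sets meeting a fixed [s]-set, doubled so that
    [s * s.-1] need not be halved. *)
Lemma bin_sub_lower (n s k : nat) : s <= n ->
  2 * (s * 'C(n.-1, k.+1)) + 2 * 'C(n - s, k.+2)
    <= 2 * 'C(n, k.+2) + s * s.-1 * 'C(n.-2, k).
Proof.
elim: s => [|s IH] lesn; first by rewrite subn0; lia.
have {}IH := IH (ltnW lesn).
have E : n - s = (n - s.+1).+1 by lia.
rewrite E binS in IH.
have := leq_bin_sub n.-1 s k.
have -> : n.-1 - s = n - s.+1 by lia.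
move: IH; rewrite [s.+1.-1]/=.
have -> : s.+1 * s * 'C(n.-2, k) = s * s.-1 * 'C(n.-2, k) + 2 * (s * 'C(n.-2, k)).
  by rewrite [2 * _]mulnA -mulnDl; congr (_ * _); case: (s) => // m; lia.
set x := s * s.-1 * _; set y := s * 'C(n.-2, k); rewrite mulSn.
lia.
Qed.

(** From [k.+1 * 'C(n, k.+1) = n * 'C(n.-1, k)]; this is how lower bounds on [n] enter the
    estimates. *)
Lemma leq_mul_bin (c n k : nat) : c * k.+1 <= n -> c * 'C(n.-1, k) <= 'C(n, k.+1).
Proof.
move=> H; rewrite -(leq_pmul2l (ltn0Sn k)) -mul_bin_diag mulnA leq_mul2r.
by apply/orP; right; rewrite mulnC.
Qed.

(* t^2 K^2 C(n-2,k-2) is what t K vertices of degree at most t K C(n-2,k-2) can cover. *)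
Lemma bin_greedy (n t k K : nat) : 1 < t -> 1 < k -> 0 < K ->
  2 * K ^ 2 * k * t <= n ->
  'C(n - t.-1, k) + (t * K) ^ 2 * 'C(n - 2, k - 2) <= 'C(n, k).
Proof.
case: k => [|[|k]] // t1 _ K0 Hn; rewrite !subSS !subn0.
have tn : t.-1 <= n by nia.
have := bin_sub_lower k tn; rewrite subn2.
have : 2 * K ^ 2 * t * 'C(n.-2, k) <= 'C(n.-1, k.+1) by apply: leq_mul_bin; nia.
set c := 'C(n.-2, k); set d := 'C(n.-1, _); set e := 'C(n - _, _).
move=> H1 Hl.
(* Bounding [d] below by [H1] and cancelling [c] leaves $2t^2K^2+(t-1)(t-2)\le 4K^2t(t-1)$; at $t=2$
   both sides are equal. *)
have H2 : 2 * ((t * K) ^ 2 * c) + t.-1 * t.-2 * c <= 2 * (t.-1 * d).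
  apply: (@leq_trans (2 * (t.-1 * (2 * K ^ 2 * t * c)))); last first.
    by rewrite leq_pmul2l // leq_mul2l H1 orbT.
  rewrite !mulnA -mulnDl leq_mul2r; apply/orP; right.
  case: t t1 {tn Hn Hl e H1} => [|[|t]] // _ /=.
  have q1 : 1 <= K * K by rewrite muln_gt0 K0.
  have -> : 2 * t.+2 * K * t.+2 * K = 2 * (t.+2 * t.+2) * (K * K) by lia.
  have -> : 2 * t.+1 * 2 * K * K * t.+2 = 4 * (t.+1 * t.+2) * (K * K) by lia.
  have : t.+1 * t <= t.+1 * t * (K * K) by rewrite leq_pmulr.
  set q := K * K in q1 *; clearbody q; nia.
lia.
Qed.

(** * Families of k-subsets *)

Section Draws.
Variable T : finType.
Implicit Types (V A B S X U W : {set T}) (F G : {set {set T}}) (k n : nat).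

Definition draws V k : {set {set T}} := [set A : {set T} | A \subset V & #|A| == k].

Definition meets X F := forall A, A \in F -> ~~ [disjoint X & A].

(** Deleting [u] maps these sets bijectively onto the [k]-subsets of [V] without [u] and [X]. *)
Lemma card_draws_star V X k u : u \in V -> u \notin X -> X \subset V ->
  #|[set A in draws V k.+1 | (u \in A) && [disjoint A & X]]|
    = 'C(#|V| - #|X|.+1, k).
Proof.
move=> uV uX XV.
have <- : #|V :\: (u |: X)| = #|V| - #|X|.+1.
  rewrite cardsD (setIidPr _) ?cardsU1 ?uX //.
  by rewrite subUset sub1set uV.
rewrite -cards_draws -(card_in_imset (f := fun A => u |: A)).
  apply: eq_card => A; rewrite !inE; apply/andP/imsetP => [[/andP[AV /eqP cA] /andP[uA dA]]|].
    exists (A :\ u); last by rewrite setD1K.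
    rewrite inE; apply/andP; split; last first.
      by move: cA; rewrite (cardsD1 u) uA add1n => -[->].
    apply/subsetP => x; rewrite !inE => /andP[xu xA].
    by rewrite negb_or xu (disjointFr dA xA) (subsetP AV).
  move=> [B]; rewrite inE => /andP[/subsetP BV /eqP cB] ->.
  have uB : u \notin B by apply/negP => /BV; rewrite !inE eqxx.
  rewrite cardsU1 uB cB eqxx setU11 andbT andTb; split.
    by rewrite subUset sub1set uV; apply/subsetP => x /BV; rewrite inE => /andP[].
  rewrite -setI_eq0; apply/eqP/setP => x; rewrite !inE.
  apply/negP => /andP[/orP[/eqP->|/BV]]; first by rewrite (negPf uX).
  by rewrite !inE negb_or => /andP[/andP[_ /negPf->]].
move=> A B; rewrite !inE => /andP[/subsetP AV _] /andP[/subsetP BV _] eAB.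
have uA : u \notin A by apply/negP => /AV; rewrite !inE eqxx.
have uB : u \notin B by apply/negP => /BV; rewrite !inE eqxx.
by rewrite -(setU1K uA) eAB setU1K.
Qed.

Lemma card_draws_mem V k u : u \in V ->
  #|[set A in draws V k.+1 | u \in A]| = 'C(#|V|.-1, k).
Proof.
move=> uV; have u0 : u \notin set0 by rewrite inE.
rewrite -subn1 -(cards0 T) -(card_draws_star k uV u0 (sub0set V)).
by apply: eq_card => A; rewrite !inE disjoint_sym -setI_eq0 set0I eqxx andbT.
Qed.

Lemma card_draws_sup V S k : S \subset V ->
  #|[set A in draws V k | S \subset A]| <= 'C(#|V| - #|S|, k - #|S|).
Proof.
move=> SV; rewrite -(_ : #|V :\: S| = #|V| - #|S|); last first.
  by rewrite cardsD (setIidPr SV).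
have inj : {in [set A in draws V k | S \subset A] &, injective (fun A => A :\: S)}.
  move=> A B; rewrite !inE => /andP[_ SA] /andP[_ SB] eAB.
  by rewrite -(setID A S) -(setID B S) eAB (setIidPr SA) (setIidPr SB).
rewrite -cards_draws -(card_in_imset inj).
apply/subset_leq_card/subsetP => B /imsetP[A]; rewrite !inE.
move=> /andP[/andP[AV /eqP cA] SA] ->.
by rewrite setSD // cardsD (setIidPr SA) cA eqxx.
Qed.

(** With $n=|V|$, prescribing a third point divides the maximal pair degree by $(n-2)/(k-2)\ge c$;
    for [k = 2] no such set exists. *)
Lemma card_draws_triple V S k c : S \subset V -> #|S| = 3 -> 1 < k -> c * k <= #|V| ->
  c * #|[set A in draws V k | S \subset A]| <= 'C(#|V| - 2, k - 2).
Proof.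
move=> SV cS k1 ck; have [k2|k2] := ltnP 2 k; last first.
  rewrite (_ : [set _ in _ | _] = set0) ?cards0 ?muln0 //.
  apply/setP => A; rewrite !inE; apply/negP => /andP[/andP[_ /eqP cA]].
  by move/subset_leq_card; rewrite cS cA; lia.
apply: leq_trans (_ : c * 'C((#|V| - 2).-1, k - 3) <= _).
  by rewrite leq_mul2l -subnS -cS card_draws_sup ?orbT.
have -> : k - 2 = (k - 3).+1 by lia.
apply: leq_mul_bin; rewrite (_ : (k - 3).+1 = k - 2) ?mulnBr; last by lia.
case: c ck => // c; lia.
Qed.

Lemma card_bigcup_leq (I : finType) (P : pred I) (f : I -> {set {set T}}) d :
  (forall i, P i -> #|f i| <= d) -> #|\bigcup_(i | P i) f i| <= #|P| * d.
Proof.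
move=> H; apply: leq_trans (_ : \sum_(i | P i) #|f i| <= _).
  apply: (big_ind2 (fun (A : {set _}) m => #|A| <= m)); rewrite ?cards0 //.
  by move=> A m B p Am Bp; rewrite (leq_trans (leq_card_setU _ _)) ?leq_add.
by rewrite -sum_nat_const; apply: leq_sum.
Qed.

Lemma exists_disjoint F U d :
  (forall u, u \in U -> #|[set A in F | u \in A]| <= d) -> #|U| * d < #|F| ->
  exists2 A, A \in F & [disjoint A & U].
Proof.
move=> deg lt; apply/exists_inP; apply: contraTT lt => /exists_inPn N.
rewrite -leqNgt; apply: leq_trans (card_bigcup_leq deg).
apply/subset_leq_card/subsetP => A AF.
have /pred0Pn[x /andP[xA xU]] := N _ AF.
by apply/bigcupP; exists x => //; rewrite inE AF.
Qed.

(** In a star centred at [w], the sets through a point [u] of [U] all contain the pair [w], [u], so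
    a union bound over [U] applies with the maximal pair degree. *)
Lemma exists_disjoint_star V F U k w : F \subset draws V k -> 
  (forall A, A \in F -> w \in A) -> w \in V -> w \notin U ->
  #|U| * 'C(#|V| - 2, k - 2) < #|F| -> exists2 A, A \in F & [disjoint A & U].
Proof.
move=> FV wF wV wU; apply: exists_disjoint => u uU.
case uV : (u \in V); last first.
  rewrite (_ : [set _ in _ | _] = set0) ?cards0 //; apply/setP => A; rewrite !inE.
  apply/negP => /andP[/(subsetP FV)]; rewrite inE => /andP[/subsetP AV _] /AV.
  by rewrite uV.
have wu : w != u by apply: contraNneq wU => ->.
have <- : #|[set w; u]| = 2 by rewrite cards2 wu.
apply: leq_trans (card_draws_sup k _); last by rewrite subUset !sub1set wV uV.
apply/subset_leq_card/subsetP => A; rewrite inE => /andP[AF uA].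
by rewrite inE (subsetP FV _ AF) subUset !sub1set wF // uA.
Qed.

End Draws.

(** * Rainbow matchings *)

Section Rainbow.
Variable T : finType.
Implicit Types (V A B S X U W : {set T}) (G : {set {set T}}) (n : nat).
Implicit Types (F : nat -> {set {set T}}) (k : nat -> nat).

Definition rainbow s F := exists e : nat -> {set T},
  (forall i, 1 <= i <= s -> e i \in F i) /\
  (forall i j, 1 <= i <= s -> 1 <= j <= s -> i != j -> [disjoint e i & e j]).

Lemma rainbow_sub s F F' : (forall i, 1 <= i <= s -> F i \subset F' i) ->
  rainbow s F -> rainbow s F'.
Proof. by move=> sub [e [eF eD]]; exists e; split=> // i Hi; apply/(subsetP (sub i Hi))/eF. Qed.

(** The greedy step: [U] is the union of the sets already chosen. They are kept off [X], typically a
    vertex that the last set has to contain. *)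
Lemma rainbow_extend s F K X :
  rainbow s F -> (forall i A, 1 <= i <= s -> A \in F i -> #|A| <= K /\ [disjoint A & X]) ->
  (forall U, #|U| <= s * K -> [disjoint U & X] ->
     exists2 A, A \in F s.+1 & [disjoint A & U]) ->
  rainbow s.+1 F.
Proof.
move=> [e [eF eD]] HF HU.
have inS (i : 'I_s) : 1 <= i.+1 <= s by rewrite /= ltn_ord.
have [||A AF AU] := HU (\bigcup_(i < s) e i.+1).
- apply: leq_trans (_ : \sum_(i < s) #|e i.+1| <= _).
    apply: (big_ind2 (fun (A : {set _}) m => #|A| <= m)); rewrite ?cards0 //.
    by move=> A m B p Am Bp; rewrite (leq_trans (leq_card_setU _ _)) ?leq_add.
  rewrite -[s in s * K]card_ord -sum_nat_const; apply: leq_sum => i _.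
  by case: (HF _ _ (inS i) (eF _ (inS i))).
- rewrite disjoint_sym; apply/bigcup_disjointP => i _; rewrite disjoint_sym.
  by case: (HF _ _ (inS i) (eF _ (inS i))).
have AD i : 1 <= i <= s -> [disjoint A & e i].
  case: i => // i /= Hi; apply: disjointWr AU.
  exact: (bigcup_sup (Ordinal Hi)).
exists (fun i => if i == s.+1 then A else e i); split=> [i Hi|i j Hi Hj nij].
  by case: eqP => [->//|ne]; apply: eF; lia.
have [Ei|ni] := eqVneq i s.+1; have [Ej|nj] := eqVneq j s.+1.
- by rewrite Ei Ej eqxx in nij.
- by apply: AD; lia.
- by rewrite disjoint_sym; apply: AD; lia.
- by apply: eD => //; lia.
Qed.

Lemma card_deleted V v (k : nat) G : v \in V -> G \subset draws V k.+1 ->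
  #|G| <= #|[set A in G | v \notin A]| + 'C(#|V|.-1, k).
Proof.
move=> vV GV; rewrite -(card_draws_mem k vV).
rewrite -(cardsID [set A : {set T} | v \notin A] G).
apply: leq_add; apply/subset_leq_card/subsetP => A; rewrite !inE ?negbK.
  by [].
by case/andP => vA /(subsetP GV); rewrite inE vA => ->.
Qed.

Lemma draws_deleted V v (k : nat) G : G \subset draws V k ->
  [set A in G | v \notin A] \subset draws (V :\ v) k.
Proof.
move=> GV; apply/subsetP => A; rewrite inE => /andP[/(subsetP GV)].
by rewrite !inE subsetD1 => /andP[-> ->] ->.
Qed.

Lemma cardD1_mem V v : v \in V -> #|V :\ v| = #|V|.-1.
Proof. by move=> vV; rewrite (cardsD1 v V) vV. Qed.

(* When v has large degree in the last family, v is set aside for it and the others are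
   restricted to the complement of v; when no vertex does, any matching of the others extends. *)
Lemma rainbow_large s V k F K :
  (forall i, 1 <= i <= s -> 2 <= k i <= K /\ F i \subset draws V (k i)) ->
  (forall i, 2 <= i <= s -> 2 * K ^ 2 * k i * s <= #|V|) ->
  (forall i, 1 <= i <= s -> 'C(#|V|, k i) < #|F i| + 'C(#|V| - s.-1, k i)) ->
  rainbow s F.
Proof.
elim: s V F => [|s IH] V F HF Hn HC.
  by exists (fun=> set0); split => [[]|[]].
have sK i A : 1 <= i <= s -> A \in F i -> #|A| <= K.
  move=> Hi; have [|/andP[_ kK] /subsetP FV /FV] := HF i; first by lia.
  by rewrite inE => /andP[_ /eqP->].
have [/andP[k2 kK] FV] := HF s.+1 ltac:(lia).
(* At most [d] sets of the last family through [v] can be met by [s * K] vertices other than [v]. *)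
pose d := s * K * 'C(#|V| - 2, k s.+1 - 2).
have [/existsP[v vd]|/existsPn Nv] := boolP [exists v, d < #|[set A in F s.+1 | v \in A]|].
  have vV : v \in V.
    move: vd; apply: contraLR => vV; rewrite -leqNgt (_ : [set _ in _ | _] = set0) ?cards0 //.
    apply/setP => A; rewrite !inE; apply/negP => /andP[/(subsetP FV)].
    by rewrite inE => /andP[/subsetP AV _] /AV; apply/negP.
  have R : rainbow s (fun i => [set A in F i | v \notin A]).
    apply: (IH (V :\ v)) => i Hi.
    - have [kK1 FiV] := HF i ltac:(lia); by split=> //; apply: draws_deleted.
    - have := Hn i ltac:(lia); rewrite cardD1_mem //.
      by have [/andP[? ?] _] := HF i ltac:(lia); nia.
    - have [/andP[ki kiK] FiV] := HF i ltac:(lia).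
      have := HC i ltac:(lia); rewrite cardD1_mem //.
      case: (k i) ki FiV => // m m0 FiV; rewrite [s.+1.-1]/=.
      (* At most ['C(#|V|.-1, m)] sets contain [v], and Pascal's rule lowers the threshold by the
         same amount; [#|V| - s] is unchanged, since ground set and number of families shrink
         together. *)
      have := card_deleted vV FiV.
      have V0 : 0 < #|V| by apply/card_gt0P; exists v.
      have -> : #|V|.-1 - s.-1 = #|V| - s by lia.
      have := binS #|V|.-1 m; rewrite (prednK V0); lia.
  apply: (@rainbow_sub s.+1 (fun i => if i == s.+1 then F i else [set A in F i | v \notin A])).
    by move=> i _; case: ifP => // _; apply/subsetP => A; rewrite inE => /andP[].
  apply: (@rainbow_extend _ _ K [set v]).
  - apply: rainbow_sub R => i Hi; case: eqP => //; lia.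
  - move=> i A Hi; case: eqP => [|_]; first lia.
    rewrite inE => /andP[AF vA]; rewrite (sK _ _ Hi AF) disjoint_sym disjoints1 //.
  - move=> U UK; rewrite disjoint_sym disjoints1 => vU; rewrite eqxx.
    have [|||||A] := @exists_disjoint_star _ V [set A in F s.+1 | v \in A] U (k s.+1) v.
    + by apply: subset_trans FV; apply/subsetP => A; rewrite inE => /andP[].
    + by move=> A; rewrite inE => /andP[].
    + by [].
    + by [].
    + by apply: leq_ltn_trans vd; rewrite leq_mul2r UK orbT.
    by rewrite inE => /andP[AF _] AU; exists A.
apply: (@rainbow_extend _ _ K set0).
- apply: (IH V) => i Hi; first by apply: HF; lia.
    by apply: leq_trans (Hn i _); first rewrite leq_mul2l leqnSn orbT //; lia.
  apply: leq_trans (HC i ltac:(lia)) _; rewrite leq_add2l leq_bin2l //; lia.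
- by move=> i A Hi AF; rewrite (sK _ _ Hi AF) disjoint_sym -setI_eq0 set0I.
- move=> U UK _; apply: (@exists_disjoint _ _ _ d).
    by move=> u _; rewrite leqNgt.
  have := HC s.+1 ltac:(lia); rewrite [s.+1.-1]/=.
  (* A single family has only to be nonempty; [bin_greedy] needs at least two. *)
  case: s {IH HF sK} Hn HC @d Nv UK k2 kK FV => [|s] Hn HC d Nv UK k2 kK FV.
    by rewrite subn0 /d !mul0n muln0; lia.
  have K0 : 0 < K by apply: leq_trans kK; lia.
  have := bin_greedy (ltac:(by []) : 1 < s.+2) k2 K0 (Hn s.+2 ltac:(lia)).
  rewrite [s.+2.-1]/= => H1 H2.
  apply: leq_ltn_trans (_ : (s.+2 * K) ^ 2 * 'C(#|V| - 2, k s.+2 - 2) < _); last by lia.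
  rewrite /d mulnA leq_mul2r; apply/orP; right.
  by apply: leq_trans (leq_mul UK (leqnn _)) _; nia.
Qed.

Lemma disjointsU1 x A B : [disjoint x |: A & B] = (x \notin B) && [disjoint A & B].
Proof. by rewrite !disjoints_subset subUset sub1set inE. Qed.

(** The right side counts the sets through a vertex that avoid [s + a] others. The factor 2 is for
    [rainbow_star], where only the better of two vertices is known to be rich. *)
Lemma bin_star_large (n s a k K : nat) : 0 < s -> 1 < k <= K -> a <= K ->
  2 * K ^ 2 * k * s.+1 <= n ->
  2 * (s * K * 'C(n - 2, k - 2)) <= 'C(n - (s + a).+1, k.-1).
Proof.
case: k => [|[|k]] // s0 kK aK Hn; rewrite !subSS !subn0 subn2.
have := leq_bin_sub n.-1 (s + a) k.
have : 2 * K ^ 2 * s.+1 * 'C(n.-2, k) <= 'C(n.-1, k.+1) by apply: leq_mul_bin; nia.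
have -> : n.-1 - (s + a) = n - (s + a).+1 by lia.
set N := 'C(n.-2, k); set c := 'C(n - _, _) => H1 H2.
have : (2 * s * K + (s + a)) * N <= 2 * K ^ 2 * s.+1 * N.
  by rewrite leq_mul2r; apply/orP; right; nia.
lia.
Qed.

(** By induction: the last family receives a vertex [w] of [W] at which it is rich, the other
    families are treated inside [V :\ w] with [W :\ w], and the last set is then chosen greedily
    through [w]. *)
Lemma rainbow_star s V W A k F K :
  W \subset V -> #|W| = s -> A \subset V -> [disjoint A & W] -> #|A| <= K ->
  (forall i, 1 <= i <= s -> 2 <= k i <= K) ->
  (forall i, 2 <= i <= s -> 2 * K ^ 2 * k i * s <= #|V|) ->
  (forall i, 1 <= i <= s ->
     #|[set B in draws V (k i) | ~~ [disjoint W & B] && (B \notin F i)]|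
       < 'C(#|V| - s - #|A|, (k i).-1)) ->
  rainbow s (fun i => [set B in F i | (B \in draws V (k i)) && [disjoint B & A]]).
Proof.
move=> + + + + AK; elim: s V W => [|s IH] V W WV cW AV AW Hk Hn HC.
  by exists (fun=> set0); split => [[]|[]].
have /andP[k2 kK] := Hk s.+1 ltac:(lia).
pose X w := (W :\ w) :|: A.
have wX w : w \in W -> w \notin X w.
  by move=> wW; rewrite !inE eqxx /= (disjointFl AW wW).
have cX w : w \in W -> #|X w| = s + #|A|.
  move=> wW; rewrite cardsU (_ : _ :&: _ = set0) ?cards0 ?subn0.
    by rewrite cardD1_mem // cW.
  apply/setP => x; rewrite !inE; apply/negP => /andP[/andP[_ xW]].
  by rewrite (disjointFl AW xW).
have XV w : X w \subset V by rewrite subUset AV andbT (subset_trans (subD1set _ _)).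
(* The sets that meet [W :|: A] in [w] alone; for distinct [w] in [W] these classes are disjoint. *)
pose c w : {set {set T}} := [set B in draws V (k s.+1) | (w \in B) && [disjoint B & X w]].
have cc w : w \in W -> #|c w| = 'C(#|V| - (s + #|A|).+1, (k s.+1).-1).
  move=> wW; have := card_draws_star (k s.+1).-1 (subsetP WV w wW) (wX w wW) (XV w).
  by rewrite prednK ?cX //; lia.
pose M := [set B in draws V (k s.+1) | ~~ [disjoint W & B] && (B \notin F s.+1)].
have HM : #|M| < 'C(#|V| - (s + #|A|).+1, (k s.+1).-1).
  by apply: leq_trans (HC s.+1 ltac:(lia)) _; rewrite leq_bin2l //; lia.
have cM w : w \in W -> c w :\: F s.+1 \subset M.
  move=> wW; apply/subsetP => B; rewrite !inE => /andP[-> /andP[-> /andP[wB _]]].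
  by rewrite /= andbT; apply/pred0Pn; exists w; rewrite /= wW wB.
(* For [s = 0] one present set is enough. Otherwise the sets absent from [c w] and from [c u] are
   disjoint parts of [M], which is smaller than one class, so together more than one class is
   present and [w] or [u] has more than half of it. *)
have [w wW Hw] : exists2 w, w \in W & s * K * 'C(#|V| - 2, k s.+1 - 2) < #|c w :&: F s.+1|.
  have /card_gt0P[w wW] : 0 < #|W| by rewrite cW.
  have [s0|s0] := posnP s.
    exists w => //; rewrite {1}s0 !mul0n.
    have := cardsID (F s.+1) (c w); rewrite cc //.
    have := subset_leq_card (cM w wW); lia.
  have /card_gt0P[u] : 0 < #|W :\ w| by rewrite cardD1_mem // cW.
  rewrite !inE => /andP[uw uW].
  have N := bin_star_large s0 (Hk s.+1 ltac:(lia)) AK (Hn s.+1 ltac:(lia)).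
  have D : #|c w :\: F s.+1| + #|c u :\: F s.+1| <= #|M|.
    rewrite -cardsUI (_ : _ :&: _ = set0) ?cards0 ?addn0.
      by rewrite subset_leq_card // subUset !cM.
    apply/setP => B; rewrite !inE; apply/negP.
    move=> /andP[/andP[_ /andP[_ /andP[wB dB]]] /andP[_ /andP[_ /andP[uB _]]]].
    by move: (disjointFr dB uB); rewrite !inE uw uW.
  have := cardsID (F s.+1) (c w); have := cardsID (F s.+1) (c u); rewrite !cc //.
  have [L|] := ltnP (s * K * 'C(#|V| - 2, k s.+1 - 2)) #|c w :&: F s.+1|; first by exists w.
  by exists u => //; lia.
have wV := subsetP WV w wW.
pose G i := if i == s.+1 then c w :&: F i
  else [set B in F i | (B \in draws (V :\ w) (k i)) && [disjoint B & A]].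
apply: (@rainbow_sub _ G).
  move=> i Hi; rewrite /G; case: eqP => [->|_]; apply/subsetP => B; rewrite !inE.
    move=> /andP[/andP[-> /andP[wB dB]] ->] /=.
    by apply: disjointWr dB; apply: subsetUr.
  by rewrite subsetD1 => /andP[-> /andP[/andP[/andP[-> _] ->] ->]].
apply: (@rainbow_extend _ _ K (w |: A)).
- apply: (@rainbow_sub _ (fun i => [set B in F i |
     (B \in draws (V :\ w) (k i)) && [disjoint B & A]])).
    move=> i Hi; rewrite /G; case: eqP => //; lia.
  apply: (IH (V :\ w) (W :\ w)).
  + exact: setSD.
  + by rewrite cardD1_mem // cW.
  + by rewrite subsetD1 AV (disjointFl AW wW).
  + by apply: disjointWr AW; apply: subD1set.
  + by move=> i Hi; apply: Hk; lia.
  + move=> i Hi; have := Hn i ltac:(lia); rewrite cardD1_mem //.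
    by have /andP[? ?] := Hk i ltac:(lia); nia.
  + move=> i Hi; apply: leq_ltn_trans (leq_trans (HC i ltac:(lia)) _).
      apply/subset_leq_card/subsetP => B; rewrite !inE subsetD1.
      move=> /andP[/andP[/andP[-> _] ->] /andP[dB ->]]; rewrite /= andbT.
      by apply: contra dB; apply: disjointWl; apply: subD1set.
    by rewrite leq_bin2l // cardD1_mem //; lia.
- move=> i B Hi; rewrite /G; case: eqP => [|_]; first lia.
  rewrite !inE subsetD1 => /andP[_ /andP[/andP[/andP[_ wB] /eqP->] dB]].
  have /andP[_ ->] := Hk i ltac:(lia); split=> //.
  by rewrite disjoint_sym disjointsU1 wB disjoint_sym.
- move=> U UK; rewrite disjoint_sym disjointsU1 => /andP[wU _].
  rewrite /G eqxx; apply: (@exists_disjoint_star _ V _ U (k s.+1) w) => //.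
  + by apply/subsetP => B; rewrite inE => /andP[]; rewrite inE => /andP[].
  + by move=> B; rewrite inE => /andP[]; rewrite inE => /andP[_ /andP[]].
  + by apply: leq_ltn_trans Hw; rewrite leq_mul2r UK orbT.
Qed.

End Rainbow.

(** * Cross-intersecting graphs *)

Section Graphs.
Variable T : finType.
Implicit Types (e A p : {set T}) (x y z w : T) (P Q : {set {set T}}).

Lemma card_le_seq (U : finType) (P : {set U}) (s : seq U) : {subset P <= s} -> #|P| <= size s.
Proof. by move=> /subsetP sub; apply: leq_trans (subset_leq_card sub) (card_size s). Qed.

Lemma disjoint_pair x y A : [disjoint [set x; y] & A] = (x \notin A) && (y \notin A).
Proof. by rewrite disjointsU1 disjoints1. Qed.

Lemma card2_eq e x y : #|e| = 2 -> x \in e -> y \in e -> x != y -> e = [set x; y].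
Proof.
move=> ce xe ye xy; apply/esym/eqP; rewrite eqEcard subUset !sub1set xe ye cards2 xy ce //.
Qed.

Lemma pair_meets2 e x y z w : uniq [:: x; y; z; w] -> #|e| = 2 ->
  ~~ [disjoint [set x; y] & e] -> ~~ [disjoint [set z; w] & e] ->
  e \in [:: [set x; z]; [set x; w]; [set y; z]; [set y; w]].
Proof.
rewrite /= !inE !negb_or !andbT => /and3P[/and3P[_ xz xw] /andP[yz yw] _] ce.
rewrite !disjoint_pair !negb_and !negbK => /orP[] h /orP[] h'.
- by rewrite (card2_eq ce h h') ?eqxx.
- by rewrite (card2_eq ce h h') ?eqxx ?orbT.
- by rewrite (card2_eq ce h h') ?eqxx ?orbT.
- by rewrite (card2_eq ce h h') ?eqxx ?orbT.
Qed.

Lemma pair_meets3 e x y z : uniq [:: x; y; z] -> #|e| = 2 ->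
  ~~ [disjoint [set x; y] & e] -> ~~ [disjoint [set y; z] & e] ->
  ~~ [disjoint [set x; z] & e] -> e \in [:: [set x; y]; [set y; z]; [set x; z]].
Proof.
rewrite /= !inE !negb_or !andbT => /andP[/andP[xy xz] yz] ce.
rewrite !disjoint_pair !negb_and !negbK.
case xe: (x \in e); case ye: (y \in e); case ze : (z \in e) => //= _ _ _.
- by rewrite (card2_eq ce xe ye) ?eqxx ?orbT.
- by rewrite (card2_eq ce xe ye) ?eqxx ?orbT.
- by rewrite (card2_eq ce xe ze) ?eqxx ?orbT.
- by rewrite (card2_eq ce ye ze) ?eqxx ?orbT.
Qed.

Definition graph P := forall e, e \in P -> #|e| = 2.
Definition nonstar P := forall u, exists2 e, e \in P & u \notin e.
Definition cross P Q := forall e f, e \in P -> f \in Q -> ~~ [disjoint e & f].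

Lemma crossC P Q : cross P Q -> cross Q P.
Proof. by move=> h e f eQ fP; rewrite disjoint_sym h. Qed.

(** Compare an edge [xy] with an edge missing [x] and an edge missing [y]. Unless one of these is
    disjoint from [xy], they are [yz] and [xw]: disjoint if [z != w], closing a triangle if
    [z = w]. *)
Lemma nonstar_cases P p0 : graph P -> nonstar P -> p0 \in P ->
  (exists x y z w, uniq [:: x; y; z; w] /\ [set x; y] \in P /\ [set z; w] \in P) \/
  (exists x y z, uniq [:: x; y; z] /\ [/\ [set x; y] \in P, [set y; z] \in P & [set x; z] \in P]).
Proof.
move=> gP nP pP; have /eqP/cards2P[x [y [xy Ep]]] := gP _ pP; rewrite {}Ep in pP.
have disj q : q \in P -> x \notin q -> y \notin q ->
    exists x y z w, uniq [:: x; y; z; w] /\ [set x; y] \in P /\ [set z; w] \in P.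
  move=> qP; have /eqP/cards2P[z [w [zw Eq]]] := gP _ qP; rewrite {}Eq in qP *.
  rewrite !inE !negb_or => /andP[xz xw] /andP[yz yw].
  by exists x, y, z, w; rewrite /= !inE !negb_or xy xz xw yz yw zw.
have [q qP xq] := nP x; have [r rP yr] := nP y.
have [yq|yq] := boolP (y \in q); last by left; apply: disj qP xq yq.
have [xr|xr] := boolP (x \in r); last by left; apply: disj rP xr yr.
have /cards1P[z Ez] : #|q :\ y| == 1 by have := gP _ qP; rewrite (cardsD1 y) yq; lia.
have /cards1P[w Ew] : #|r :\ x| == 1 by have := gP _ rP; rewrite (cardsD1 x) xr; lia.
have /andP[zy zq] : (z != y) && (z \in q) by rewrite -in_setD1 Ez set11.
have /andP[wx wr] : (w != x) && (w \in r) by rewrite -in_setD1 Ew set11.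
have Eq : q = [set y; z] by apply: card2_eq => //; [apply: gP | rewrite eq_sym].
have Er : r = [set x; w] by apply: card2_eq => //; [apply: gP | rewrite eq_sym].
rewrite Eq in qP; rewrite Er in rP.
have xz : x != z by apply: contraNneq xq => ->.
have yw : y != w by apply: contraNneq yr => ->.
have [Ezw|zw] := eqVneq z w.
  right; exists x, y, z; rewrite /= !inE !negb_or xy xz eq_sym zy; split=> //.
  by split=> //; rewrite Ezw.
left; exists y, z, x, w; rewrite /= !inE !negb_or [y == z]eq_sym zy [y == x]eq_sym xy yw.
by rewrite [z == x]eq_sym xz zw [x == w]eq_sym wx.
Qed.

(** Common form of the triangle and of the path with three edges, whose middle edge is [p1]. *)
Definition three_pairs P Q := exists p1 p2 p3,
  [/\ p1 \in P, p2 \in P, p3 \in P, ~~ [disjoint p1 & p2] & ~~ [disjoint p1 & p3]] /\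
  [/\ p1 != p2, p1 != p3 & forall A, meets A Q -> [|| p1 \subset A, p2 \subset A | p3 \subset A]].

Definition cross_concl P Q :=
  [\/ #|P| <= 2 /\ #|Q| <= 4, #|Q| <= 2 | [/\ #|P| <= 3, #|Q| <= 3 & three_pairs P Q]].

(** Here [P] is the path [z x w y], and [Q] lies in the path [y x w z]. If [Q] contains the shared
    middle edge [xw], both are full paths; otherwise [Q] has at most two edges. *)
Lemma cross_path P Q x y z w : graph P -> graph Q -> cross P Q -> uniq [:: x; y; z; w] ->
  [set x; y] \in Q -> [set z; w] \in Q -> [set x; z] \in P -> [set y; w] \in P ->
  [set x; w] \in P -> [set y; z] \notin P -> cross_concl P Q.
Proof.
move=> gP gQ c u xyQ zwQ xzP ywP xwP yzP.
have := u; rewrite /= !inE !negb_or !andbT => /and3P[/and3P[xy xz xw] /andP[yz yw] zw].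
have HP : #|P| <= 3.
  apply: (@card_le_seq _ _ [:: [set x; z]; [set x; w]; [set y; w]]) => e eP.
  have := pair_meets2 u (gP _ eP) (crossC c xyQ eP) (crossC c zwQ eP).
  by rewrite !inE => /or4P[->|->|/eqP E|->]; rewrite ?orbT //; rewrite -E eP in yzP.
have HQ e : e \in Q -> e \in [:: [set x; y]; [set x; w]; [set z; w]].
  move=> eQ; have u' : uniq [:: x; z; y; w].
    by rewrite /= !inE !negb_or xz xy xw zw yw [z == y]eq_sym yz.
  have := pair_meets2 u' (gQ _ eQ) (c _ _ xzP eQ) (c _ _ ywP eQ).
  rewrite !inE => /or4P[->|->|/eqP E|->]; rewrite ?orbT //.
  have := c _ _ xwP eQ; rewrite E disjoint_pair !inE !negb_or.
  by rewrite xz xy [w == z]eq_sym zw [w == y]eq_sym yw.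
have HQ3 := card_le_seq HQ.
have [xwQ|xwQ] := boolP ([set x; w] \in Q); last first.
  apply: Or32; apply: (@card_le_seq _ _ [:: [set x; y]; [set z; w]]) => e eQ.
  by have := HQ _ eQ; rewrite !inE => /or3P[->|/eqP E|->]; rewrite ?orbT //; rewrite -E eQ in xwQ.
apply: Or33; split=> //; exists [set x; w], [set x; z], [set y; w]; split.
  by split; rewrite // disjoint_pair !inE !eqxx ?orbT ?andbF.
split.
- apply/eqP => E; have := set22 x w.
  by rewrite E !inE [w == x]eq_sym (negPf xw) [w == z]eq_sym (negPf zw).
- by apply/eqP => E; have := set21 x w; rewrite E !inE (negPf xy) (negPf xw).
move=> A mA; have := mA _ xyQ; have := mA _ zwQ; have := mA _ xwQ.
rewrite ![[disjoint A & _]]disjoint_sym !disjoint_pair !subUset !sub1set.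
by do 4!case: (_ \in A).
Qed.

(** Two disjoint edges of [Q] confine [P] to the four-cycle of pairs joining them. A triangle in [Q]
    confines [P] to that triangle; being no star, [P] is all of it and confines [Q] in turn. *)
Lemma cross_nonstar P Q : graph P -> graph Q -> nonstar P -> nonstar Q -> cross P Q ->
  0 < #|Q| -> cross_concl P Q.
Proof.
move=> gP gQ nP nQ c /card_gt0P[q0 q0Q].
have [[x [y [z [w [u [xyQ zwQ]]]]]]|[x [y [z [u [xyQ yzQ xzQ]]]]]] := nonstar_cases gQ nQ q0Q.
  have core x' y' z' w' : uniq [:: x'; y'; z'; w'] -> [set x'; y'] \in Q -> [set z'; w'] \in Q ->
      [set x'; z'] \in P -> [set y'; w'] \in P -> cross_concl P Q.
    move: x' y' z' w' => {u xyQ zwQ}x {}y {}z {}w u xyQ zwQ xzP ywP.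
    have := u; rewrite /= !inE !negb_or !andbT => /and3P[/and3P[xy xz xw] /andP[yz yw] zw].
    have u' : uniq [:: x; z; y; w].
      by rewrite /= !inE !negb_or xz xy xw zw yw [z == y]eq_sym yz.
    have HP e (eP : e \in P) := pair_meets2 u (gP _ eP) (crossC c xyQ eP) (crossC c zwQ eP).
    have HQ e (eQ : e \in Q) := pair_meets2 u' (gQ _ eQ) (c _ _ xzP eQ) (c _ _ ywP eQ).
    (* The other two edges of the cycle decide: both in [P] leave only [xy] and [zw] for [Q],
       exactly one gives the path, and none leaves two edges in [P]. *)
    have [xwP|xwP] := boolP ([set x; w] \in P); have [yzP|yzP] := boolP ([set y; z] \in P).
    - apply: Or32; apply: (@card_le_seq _ _ [:: [set x; y]; [set z; w]]) => e eQ.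
      have := HQ _ eQ; rewrite !inE => /or4P[->|/eqP E|/eqP E|->]; rewrite ?orbT //.
        have := c _ _ yzP eQ; rewrite E disjoint_pair !inE !negb_or.
        by rewrite [y == x]eq_sym xy yw [z == x]eq_sym xz zw.
      have := c _ _ xwP eQ; rewrite E disjoint_pair !inE !negb_or.
      by rewrite xz xy [w == z]eq_sym zw [w == y]eq_sym yw.
    - exact: cross_path u xyQ zwQ xzP ywP xwP yzP.
    - apply: (@cross_path _ _ y x w z); rewrite // 1?[[set y; x]]setUC 1?[[set w; z]]setUC //.
      by rewrite /= !inE !negb_or [y == x]eq_sym xy yw yz xw xz [w == z]eq_sym zw.
    - apply: Or31; split; last by have := card_le_seq HQ.
      apply: (@card_le_seq _ _ [:: [set x; z]; [set y; w]]) => e eP.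
      have := HP _ eP; rewrite !inE => /or4P[->|/eqP E|/eqP E|->]; rewrite ?orbT //.
        by rewrite -E eP in xwP.
      by rewrite -E eP in yzP.
  have HP e (eP : e \in P) := pair_meets2 u (gP _ eP) (crossC c xyQ eP) (crossC c zwQ eP).
  have := u; rewrite /= !inE !negb_or !andbT => /and3P[/and3P[xy xz xw] /andP[yz yw] zw].
  have cw : uniq [:: x; y; w; z].
    by rewrite /= !inE !negb_or xz xy xw yw yz [w == z]eq_sym zw.
  (* A subgraph of a four-cycle that is no star contains two opposite edges; this is checked on
     edges missing each of the four vertices. *)
  have [[xzP ywP]|[xwP yzP]] : ([set x; z] \in P /\ [set y; w] \in P) \/
      ([set x; w] \in P /\ [set y; z] \in P).
    have [e1 e1P m1] := nP x; have [e2 e2P m2] := nP y.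
    have [e3 e3P m3] := nP z; have [e4 e4P m4] := nP w.
    move: (HP _ e1P) (HP _ e2P) (HP _ e3P) (HP _ e4P).
    rewrite !inE => /or4P[] /eqP E1; rewrite {}E1 in e1P m1; move: m1;
      rewrite !inE ?eqxx ?orbT //= => _; 
    move=> /or4P[] /eqP E2; rewrite {}E2 in e2P m2; move: m2;
      rewrite !inE ?eqxx ?orbT //= => _; 
    move=> /or4P[] /eqP E3; rewrite {}E3 in e3P m3; move: m3;
      rewrite !inE ?eqxx ?orbT //= => _; 
    move=> /or4P[] /eqP E4; rewrite {}E4 in e4P m4; move: m4;
      rewrite !inE ?eqxx ?orbT //= => _; by auto.
    exact: core u xyQ zwQ xzP ywP.
  by apply: core cw xyQ _ xwP yzP; rewrite setUC.
have HP e (eP : e \in P) :=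
  pair_meets3 u (gP _ eP) (crossC c xyQ eP) (crossC c yzQ eP) (crossC c xzQ eP).
have := u; rewrite /= !inE !negb_or !andbT => /andP[/andP[xy xz] yz].
have [[e1 e1P m1] [e2 e2P m2] [e3 e3P m3]] := And3 (nP x) (nP y) (nP z).
have yzP : [set y; z] \in P.
  by move: (HP _ e1P); rewrite !inE => /or3P[] /eqP E; move: e1P m1; rewrite E // !inE eqxx.
have xzP : [set x; z] \in P.
  by move: (HP _ e2P); rewrite !inE => /or3P[] /eqP E; move: e2P m2; rewrite E // !inE eqxx ?orbT.
have xyP : [set x; y] \in P.
  by move: (HP _ e3P); rewrite !inE => /or3P[] /eqP E; move: e3P m3; rewrite E // !inE eqxx ?orbT.
have HQ e (eQ : e \in Q) := pair_meets3 u (gQ _ eQ) (c _ _ xyP eQ) (c _ _ yzP eQ) (c _ _ xzP eQ).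
apply: Or33; split; [exact: card_le_seq HP | exact: card_le_seq HQ |].
exists [set x; y], [set y; z], [set x; z]; split.
  by split; rewrite // disjoint_pair !inE !eqxx ?orbT ?andbF.
split.
- by apply/eqP => E; have := set21 x y; rewrite E !inE (negPf xy) (negPf xz).
- by apply/eqP => E; have := set22 x y; rewrite E !inE [y == x]eq_sym (negPf xy) (negPf yz).
move=> A mA; have := mA _ xyQ; have := mA _ yzQ; have := mA _ xzQ.
rewrite ![[disjoint A & _]]disjoint_sym !disjoint_pair !subUset !sub1set.
by do 3!case: (_ \in A).
Qed.

End Graphs.

(** * Heavy pairs *)

Section Base.
Variable T : finType.
Implicit Types (V A B S X e p q : {set T}) (F G E P Q : {set {set T}}) (k n a m : nat).

(** Bonferroni on [n.-1] points gives $f>mN-\binom m2 N'$ with $N=\binom{n-2}{k-2}$ and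
    $N'=\binom{n-3}{k-3}\le N/(2am)$. For [k = 2] simply $N=1$ and $f>m$. *)
Lemma draws_lower n k m a (f : nat) : 1 < k -> 1 < m -> 0 < a -> 2 * a * k * m <= n ->
  'C(n.-1, k.-1) < f + 'C(n.-1 - m, k.-1) ->
  4 * a * m * 'C(n - 2, k - 2) < 4 * a * f + m.-1 * 'C(n - 2, k - 2).
Proof.
case: k => [|[|[|k]]] // _ m1 a0 Hn; rewrite subn2 ?subnn.
  have mn : m < n by nia.
  rewrite bin0 !bin1 => H; have mf : m < f by lia.
  nia.
have mn : m <= n.-1 by nia.
have := bin_sub_lower k mn.
have : 2 * a * m * 'C(n.-2.-1, k) <= 'C(n.-2, k.+1) by apply: leq_mul_bin; nia.
rewrite [k.+3.-1]/= (_ : k.+3 - 2 = k.+1) //.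
set N := 'C(n.-2, _); set t := 'C(_, k); set c := 'C(n.-1, _); set d := 'C(_ - m, _).
move=> HT HL Hlt; have : 2 * (m * N) < 2 * f + m * m.-1 * t by lia.
rewrite -(ltn_pmul2l (_ : 0 < 2 * a)); last by lia.
move/leq_trans; have : m.-1 * (2 * a * m * t) <= m.-1 * N by rewrite leq_mul2l HT orbT.
move=> Ht; have -> : 4 * a * m * N = 2 * a * (2 * (m * N)) by lia.
by apply; lia.
Qed.

Lemma card_pair_degree V F k e : F \subset draws V k -> #|e| = 2 ->
  #|[set A in F | e \subset A]| <= 'C(#|V| - 2, k - 2).
Proof.
move=> FV ce; have [eV|eV] := boolP (e \subset V).
  rewrite -ce; apply: leq_trans (card_draws_sup k eV).
  by apply/subset_leq_card/subsetP => A; rewrite !inE => /andP[/(subsetP FV)]; rewrite inE => ->.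
rewrite (_ : [set _ in _ | _] = set0) ?cards0 //; apply/setP => A; rewrite !inE.
apply: contraNF eV => /andP[/(subsetP FV)]; rewrite inE => /andP[AV _] eA.
exact: subset_trans eA AV.
Qed.

(** In use [N] is the largest possible degree of a pair, so that heavy means a degree above the
    fraction [1 / L] of it. *)
Definition heavy F L N := [set e : {set T} | (#|e| == 2) &&
  (N < L * #|[set A in F | e \subset A]|)].

Lemma heavy_graph F L N : graph (heavy F L N).
Proof. by move=> e; rewrite inE => /andP[/eqP]. Qed.

Lemma heavy_sub V F k L N e : F \subset draws V k -> e \in heavy F L N -> e \subset V.
Proof.
move=> FV; rewrite inE => /andP[_].
have [->|/set0Pn[A]] := eqVneq [set A in F | e \subset A] set0.
  by rewrite cards0 muln0.
by rewrite inE => /andP[/(subsetP FV)]; rewrite inE => /andP[AV _] /subset_trans -> .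
Qed.

(** If [X] missed [e], each member of [F] containing [e] would contain one of at most [l] triples,
    and each triple has degree at most [N / (L * l)], where [N] is the maximal pair degree. *)
Lemma heavy_meets V F k l L X e : F \subset draws V k -> 1 < k -> 0 < l -> 0 < L ->
  L * k * l <= #|V| -> #|X| <= l -> meets X F -> e \in heavy F L 'C(#|V| - 2, k - 2) ->
  ~~ [disjoint X & e].
Proof.
move=> FV k1 l0 L0 Hn Xl mX eH; have eV := heavy_sub FV eH.
move: eH; rewrite inE => /andP[/eqP ce]; apply: contraTN => dXe; rewrite -leqNgt.
set N := 'C(_, _); have Ll0 : 0 < L * l by rewrite muln_gt0 L0.
have sub : [set A in F | e \subset A] \subset
    \bigcup_(x in X :&: V) [set A in draws V k | (x |: e) \subset A].
  apply/subsetP => A; rewrite inE => /andP[AF eA].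
  have /pred0Pn[x /= /andP[xX xA]] := mX _ AF.
  have := subsetP FV _ AF; rewrite inE => /andP[AV cA].
  apply/bigcupP; exists x; first by rewrite inE xX (subsetP AV).
  by rewrite !inE AV cA subUset sub1set xA eA.
have := leq_trans (subset_leq_card sub) (@card_bigcup_leq _ _ _ _ (N %/ (L * l)) _).
move=> -/(_ _)/leq_trans H.
apply: (@leq_trans (L * (l * (N %/ (L * l))))); last by rewrite mulnA mulnC leq_divM.
rewrite leq_mul2l; apply/orP; right; apply: H; last first.
  by rewrite leq_mul2r (leq_trans (subset_leq_card (subsetIl _ _)) Xl) orbT.
move=> x /setIP[xX xV]; rewrite leq_divRL // mulnC; apply: card_draws_triple => //.
- by rewrite subUset sub1set xV.
- by rewrite cardsU1 ce (disjointFr dXe xX).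
- by rewrite mulnAC.
Qed.

(** Heavy pairs of [E] account for at most [N] sets each, all others for at most [N / L], with [N]
    the maximal pair degree. The number of heavy pairs is added on the left to avoid a
    subtraction. *)
Lemma cover_bound V F k L E M : F \subset draws V k -> 0 < L -> graph E ->
  (forall A, A \in F -> exists2 e, e \in E & e \subset A) -> #|E| <= M ->
  L * #|F| + #|heavy F L 'C(#|V| - 2, k - 2)| * 'C(#|V| - 2, k - 2)
    <= (L * #|heavy F L 'C(#|V| - 2, k - 2)| + M) * 'C(#|V| - 2, k - 2).
Proof.
move=> FV L0 gE cE EM; set N := 'C(_, _); set P := heavy _ _ _.
have sub : F \subset (\bigcup_(e in E :&: P) [set A in F | e \subset A]) :|:
    \bigcup_(e in E :\: P) [set A in F | e \subset A].
  apply/subsetP => A AF; have [e eE eA] := cE _ AF; rewrite inE.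
  have AS : A \in [set A in F | e \subset A] by rewrite inE AF.
  have [eP|eP] := boolP (e \in P); apply/orP; [left|right]; apply/bigcupP; exists e => //.
    by rewrite in_setI eE.
  by rewrite in_setD eP.
have H1 : #|\bigcup_(e in E :&: P) [set A in F | e \subset A]| <= #|E :&: P| * N.
  by apply: card_bigcup_leq => e /setIP[eE _]; apply: card_pair_degree FV (gE _ eE).
have H2 : #|\bigcup_(e in E :\: P) [set A in F | e \subset A]| <= #|E :\: P| * (N %/ L).
  apply: card_bigcup_leq => e /setDP[eE]; rewrite inE gE // eqxx /= -leqNgt.
  by rewrite leq_divRL // mulnC.
have := leq_trans (leq_trans (subset_leq_card sub) (leq_card_setU _ _)) (leq_add H1 H2).
have := leq_divM N L; have := cardsID P E.
have : #|E :&: P| <= #|P| by rewrite subset_leq_card ?subsetIr.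
move: #|F| #|P| #|E :&: P| #|E :\: P| (N %/ L) => f p x y d xp xy dN H.
have : L * f <= L * x * N + y * N.
  apply: leq_trans (leq_mul (leqnn L) H) _; rewrite mulnDr mulnA leq_add2l.
  by rewrite mulnCA [L * d]mulnC leq_mul2l dN orbT.
move=> {}H; rewrite -(leq_add2r (p * N)) in H; apply: leq_trans H _.
rewrite -!mulnDl leq_mul2r; apply/orP; right.
case: L L0 {dN FV P sub H1 H2} => // L _.
rewrite -xy in EM; have H := leq_mul (leqnn L) xp; rewrite !mulSn; lia.
Qed.

Lemma heavy_count V F k m a E M : F \subset draws V k -> 1 < k -> 1 < m -> 0 < a ->
  2 * a * k * m <= #|V| -> 'C(#|V|.-1, k.-1) < #|F| + 'C(#|V|.-1 - m, k.-1) -> graph E ->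
  (forall A, A \in F -> exists2 e, e \in E & e \subset A) -> #|E| <= M ->
  4 * a * m + 2 * #|heavy F (2 * a) 'C(#|V| - 2, k - 2)| <
    4 * a * #|heavy F (2 * a) 'C(#|V| - 2, k - 2)| + 2 * M + m.-1.
Proof.
move=> FV k1 m1 a0 Hn HF gE cE EM.
have := draws_lower k1 m1 a0 Hn HF.
have := cover_bound FV (ltac:(lia) : 0 < 2 * a) gE cE EM.
set N := 'C(_ - 2, _); set p := #|heavy _ _ _| => H1 H2.
have H3 : (4 * a * m + 2 * p) * N < (4 * a * p + 2 * M + m.-1) * N by rewrite !mulnDl; lia.
by move: H3; rewrite ltn_mul2r => /andP[].
Qed.

(** A member of [F] meets [B0] in some [u], and meets a chosen member of [G] missing [u] in some
    [v]. *)
Lemma cover_pairs F G m : (forall B, B \in G -> #|B| = m /\ meets B F) -> 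
  (forall u, exists2 B, B \in G & u \notin B) -> forall B0, B0 \in G ->
  exists E, [/\ graph E, #|E| <= m ^ 2 & forall A, A \in F -> exists2 e, e \in E & e \subset A].
Proof.
move=> HG HB B0 B0G.
have [f Hf] : exists f : T -> {set T}, forall u, f u \in G /\ u \notin f u.
  by apply: (@fin_all_exists T (fun=> {set T}) (fun u B => B \in G /\ u \notin B)) => u;
    have [B ? ?] := HB u; exists B.
have [cB0 mB0] := HG _ B0G.
exists (\bigcup_(u in B0) [set [set u; v] | v in f u]); split.
- move=> e /bigcupP[u _ /imsetP[v vf ->]]; rewrite cards2.
  have [_ /negP uf] := Hf u; by case: eqP => // E; rewrite -E in vf.
- rewrite -mulnn -{1}cB0; apply: card_bigcup_leq => u _.
  by apply: leq_trans (leq_imset_card _ _) _; case: (HG _ (proj1 (Hf u))) => ->.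
- move=> A AF; have /pred0Pn[u /= /andP[uB uA]] := mB0 _ AF.
  have [fG _] := Hf u; have [_ mf] := HG _ fG.
  have /pred0Pn[v /= /andP[vf vA]] := mf _ AF.
  exists [set u; v]; last by rewrite subUset !sub1set uA.
  by apply/bigcupP; exists u => //; apply: imset_f.
Qed.

(** Disjoint [p] and [q] give four pairs. If they share [x], a member of [F] contains both other
    ends, or it contains [x] and a point of a fixed [B] missing [x]. *)
Lemma cover_pairs_of_two F G m p q : (forall B, B \in G -> #|B| = m /\ meets B F) -> 
  (forall u, exists2 B, B \in G & u \notin B) -> #|p| = 2 -> #|q| = 2 -> p != q ->
  meets p F -> meets q F ->
  exists E, [/\ graph E, #|E| <= maxn m.+1 4
    & forall A, A \in F -> exists2 e, e \in E & e \subset A].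
Proof.
move=> HG HB cp cq pq mp mq; have [d|/pred0Pn[x /= /andP[xp xq]]] := boolP [disjoint p & q].
  exists (\bigcup_(u in p) [set [set u; v] | v in q]); split.
  - move=> e /bigcupP[u up /imsetP[v vq ->]]; rewrite cards2.
    by case: eqP => // E; rewrite -E (disjointFr d up) in vq.
  - rewrite leq_max; apply/orP; right; rewrite -[4]/(2 * 2) -{1}cp -cq.
    by apply: card_bigcup_leq => u _; apply: leq_imset_card.
  - move=> A AF; have /pred0Pn[u /= /andP[up uA]] := mp _ AF.
    have /pred0Pn[v /= /andP[vq vA]] := mq _ AF.
    exists [set u; v]; last by rewrite subUset !sub1set uA.
    by apply/bigcupP; exists u => //; apply: imset_f.
have /cards1P[z Ez] : #|p :\ x| == 1 by have := cp; rewrite (cardsD1 x) xp; lia.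
have /cards1P[w Ew] : #|q :\ x| == 1 by have := cq; rewrite (cardsD1 x) xq; lia.
have /andP[zx zp] : (z != x) && (z \in p) by rewrite -in_setD1 Ez set11.
have /andP[wx wq] : (w != x) && (w \in q) by rewrite -in_setD1 Ew set11.
have Ep : p = [set x; z] by apply: card2_eq => //; rewrite eq_sym.
have Eq : q = [set x; w] by apply: card2_eq => //; rewrite eq_sym.
have zw : z != w by apply: contraNneq pq => E; rewrite Ep Eq E.
have [B BG xB] := HB x; have [cB mB] := HG _ BG.
exists ([set z; w] |: [set [set x; v] | v in B]); split.
- move=> e /setU1P[->|/imsetP[v vB ->]]; rewrite cards2 ?zw //.
  by case: eqP => // E; rewrite E vB in xB.
- rewrite leq_max; apply/orP; left; apply: leq_trans (leq_card_setU _ _) _.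
  by rewrite cards1 add1n ltnS -cB leq_imset_card.
- move=> A AF; have := mp _ AF; have := mq _ AF; have /pred0Pn[v /= /andP[vB vA]] := mB _ AF.
  rewrite Ep Eq !disjoint_pair; have [xA _ _|xA] := boolP (x \in A).
    exists [set x; v]; last by rewrite subUset !sub1set xA.
    by apply/setU1P; right; apply: imset_f.
  rewrite /= !negbK => wA zA; exists [set z; w]; first by apply/setU1P; left.
  by rewrite subUset !sub1set zA.
Qed.

(** If all edges contained [u], their other ends would lie in both of two distinct [m]-sets of [G]
    missing [u], so there would be fewer than [m] edges. *)
Lemma nonstar_of_missed P G m : graph P -> m <= #|P| ->
  (forall B, B \in G -> #|B| = m /\ meets B P) ->
  (forall u, 1 < #|[set B in G | u \notin B]|) -> nonstar P.
Proof.
move=> gP mP HG HB u; apply/exists_inP; apply: contraT => /exists_inPn N.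
have {}N e : e \in P -> u \in e by move/N; rewrite negbK.
have /card_gt1P[B [B' [+ + BB]]] := HB u.
rewrite !inE => /andP[BG uB] /andP[B'G uB'].
have [[cB mB] [cB' mB']] := (HG _ BG, HG _ B'G).
have sub : P \subset [set [set u; v] | v in B :&: B'].
  apply/subsetP => e eP; have ue := N _ eP.
  have /pred0Pn[v /= /andP[vB ve]] := mB _ eP.
  have /pred0Pn[v' /= /andP[vB' ve']] := mB' _ eP.
  have uv : u != v by apply: contraNneq uB => ->.
  have uv' : u != v' by apply: contraNneq uB' => ->.
  have Ee := card2_eq (gP _ eP) ue ve uv.
  have E : v' = v by move: ve'; rewrite Ee !inE eq_sym (negPf uv') => /eqP.
  by apply/imsetP; exists v => //; rewrite inE vB -E.
have := leq_trans mP (leq_trans (subset_leq_card sub) (leq_imset_card _ _)).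
rewrite leqNgt => /negP; case; rewrite -cB; apply: proper_card.
rewrite properEneq subsetIl andbT; apply: contraNneq BB => /setIidPl sBB.
by rewrite eqEcard sBB cB cB' leqnn.
Qed.

(** Members of [G] through [u] must meet [A], which excludes ['C(#|V|.-1 - m, l.-1)] of the sets
    through [u]. The [+ 1] in the size hypothesis yields two sets missing [u] instead of one. *)
Lemma two_missed V F G A m l u : G \subset draws V l -> 0 < l -> A \subset V -> #|A| = m ->
  meets A G -> u \notin A -> 'C(#|V|.-1, l.-1) + 1 < #|G| + 'C(#|V|.-1 - m, l.-1) ->
  1 < #|[set B in G | u \notin B]|.
Proof.
case: l => // l GV _ AV cA mA uA; rewrite [l.+1.-1]/= => HG.
have [uV|uV] := boolP (u \in V); last first.
  rewrite (_ : [set B in G | _] = G); last first.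
    apply/setP => B; rewrite !inE andbC; apply: andb_idl => /(subsetP GV).
    by rewrite inE => /andP[/subsetP BV _]; apply: contra uV => /BV.
  have := leq_bin2l l (leq_subr m #|V|.-1); lia.
rewrite -(cardsID [set B : {set T} | u \notin B] G) in HG.
have -> : [set B in G | u \notin B] = G :&: [set B : {set T} | u \notin B].
  by apply/setP => B; rewrite !inE.
suff : #|G :\: [set B : {set T} | u \notin B]| + 'C(#|V|.-1 - m, l) <= 'C(#|V|.-1, l).
  (* elaboration leaves [reverse_coercion] in some cardinals, which [lia] sees as distinct atoms *)
  by unfold reverse_coercion in *; lia.
rewrite -(card_draws_mem l uV) -cA (_ : #|V|.-1 - #|A| = #|V| - #|A|.+1); last by lia.
rewrite -(card_draws_star l uV uA AV) -cardsUI (_ : _ :&: _ = set0) ?cards0 ?addn0.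
  apply/subset_leq_card/subsetP => B; rewrite !inE negbK.
  by case/orP => [/andP[-> /(subsetP GV)]|/and3P[-> -> _]] //; rewrite inE => ->.
apply/setP => B; rewrite !inE; apply/negP => /andP[/andP[_ BG] /andP[_ /andP[_ dB]]].
by have := mA _ BG; rewrite disjoint_sym dB.
Qed.

(** The pair [p1] accounts for at most [#|V| - 2] triples; each of the others adds at most
    [#|V| - 3], because its union with [p1] is already counted. *)
Lemma card_three_pairs V F p1 p2 p3 : F \subset draws V 3 ->
  p1 \subset V -> p2 \subset V -> p3 \subset V -> #|p1| = 2 -> #|p2| = 2 -> #|p3| = 2 ->
  ~~ [disjoint p1 & p2] -> ~~ [disjoint p1 & p3] -> p1 != p2 -> p1 != p3 ->
  (forall A, A \in F -> [|| p1 \subset A, p2 \subset A | p3 \subset A]) ->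
  #|F| + 8 <= 3 * #|V|.
Proof.
move=> FV V1 V2 V3 c1 c2 c3 d2 d3 n2 n3 HF.
pose S p := [set A in draws V 3 | p \subset A].
have cS p : p \subset V -> #|p| = 2 -> #|S p| <= #|V| - 2.
  by move=> pV cp; have := card_draws_sup 3 pV; rewrite cp bin1.
have cD p : p \subset V -> #|p| = 2 -> ~~ [disjoint p1 & p] -> p1 != p ->
    #|S p :\: S p1| + 3 <= #|V| /\ 3 <= #|V|.
  move=> pV cp d n.
  have q3 : #|p1 :|: p| = 3.
    have : 0 < #|p1 :&: p|.
      by rewrite lt0n cards_eq0; apply: contra d; rewrite setI_eq0.
    have : #|p1 :&: p| < 2.
      rewrite -c1; apply: proper_card; rewrite properEneq subsetIl andbT.
      by apply: contraNneq n => /setIidPl s; rewrite eqEcard s c1 cp.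
    by have := cardsUI p1 p; lia.
  have qV : p1 :|: p \subset V by rewrite subUset V1.
  have := subset_leq_card qV; rewrite q3 => V3'; split=> //.
  have : 0 < #|S p :&: S p1|.
    apply/card_gt0P; exists (p1 :|: p); rewrite !inE qV q3 eqxx subsetUr subsetUl //.
  by have := cardsID (S p1) (S p); have := cS p pV cp; lia.
have [[D2 n3'] [D3 _]] := (cD p2 V2 c2 d2 n2, cD p3 V3 c3 d3 n3).
have sub : F \subset S p1 :|: ((S p2 :\: S p1) :|: (S p3 :\: S p1)).
  apply/subsetP => A AF; have := subsetP FV _ AF; have := HF _ AF.
  rewrite !inE; by do 3!case: (_ \subset _); do ?case: (_ == _); do ?case: (_ \subset _).
have := leq_trans (subset_leq_card sub) (leq_trans (leq_card_setU _ _)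
  (leq_add (cS _ V1 c1) (leq_card_setU _ _))).
lia.
Qed.

End Base.

(** * Cross-intersecting families *)

Section CrossStar.
Variable T : finType.
Implicit Types (V A B S X e p q : {set T}) (F G E P Q : {set {set T}}) (k n a m : nat).

(** The crude cover by [m ^ 2] pairs gives two heavy pairs; two pairs met by all of [F] give a
    smaller cover, which raises the bound to [m]. *)
Lemma heavy_large V F G k m a : F \subset draws V k -> 1 < k -> 1 < m <= a ->
  2 * a * k * m <= #|V| -> 'C(#|V|.-1, k.-1) < #|F| + 'C(#|V|.-1 - m, k.-1) ->
  (forall B, B \in G -> #|B| = m /\ meets B F) -> (forall u, exists2 B, B \in G & u \notin B) ->
  0 < #|G| -> let P := heavy F (2 * a) 'C(#|V| - 2, k - 2) in
  1 < #|P| /\ forall Q, graph Q -> 1 < #|Q| -> (forall q, q \in Q -> meets q F) -> m <= #|P|.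
Proof.
move=> FV k1 /andP[m1 ma] Hn HF HG HB /card_gt0P[B0 B0G] P.
have a0 : 0 < a by lia.
have P1 : 1 < #|P|.
  have [E [gE cE EF]] := cover_pairs HG HB B0G.
  have := heavy_count FV k1 m1 a0 Hn HF gE EF cE; rewrite -/P ltnNge => H.
  by rewrite ltnNge; apply: contra H => H; nia.
split=> // Q gQ /card_gt1P[p [q [pQ qQ pq]]] mQ.
have [E [gE cE EF]] := cover_pairs_of_two HG HB (gQ _ pQ) (gQ _ qQ) pq (mQ _ pQ) (mQ _ qQ).
have := heavy_count FV k1 m1 a0 Hn HF gE EF cE; rewrite -/P ltnNge => H.
rewrite leqNgt; apply: contra H => H.
(* Here [1 < #|P| < m], so [m] is at least 3. *)
have -> : maxn m.+1 4 = m.+1 by lia.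
nia.
Qed.

Lemma sub_heavy V F L : F \subset draws V 2 -> 1 < L -> F \subset heavy F L 'C(#|V| - 2, 2 - 2).
Proof.
move=> FV L1; apply/subsetP => e eF; have := subsetP FV _ eF.
rewrite !inE bin0 => /andP[_ ->]; apply: leq_trans L1 _; rewrite leq_pmulr //.
by apply/card_gt0P; exists e; rewrite inE eF subxx.
Qed.

Lemma cross_star V F G a b : F \subset draws V a -> G \subset draws V b -> 1 < b <= a ->
  2 * a ^ 2 * b <= #|V| -> cross F G ->
  'C(#|V|.-1, a.-1) + 1 < #|F| + 'C(#|V|.-1 - b, a.-1) ->
  'C(#|V|.-1, b.-1) + 1 < #|G| + 'C(#|V|.-1 - a, b.-1) ->
  exists2 w, w \in V & (forall A, A \in F -> w \in A) /\ (forall A, A \in G -> w \in A).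
Proof.
move=> FV GV /andP[b1 ba] Hn cFG HF HG.
have a1 : 1 < a by lia.
have F0 : 0 < #|F| by have := leq_bin2l a.-1 (leq_subr b #|V|.-1); lia.
have G0 : 0 < #|G| by have := leq_bin2l b.-1 (leq_subr a #|V|.-1); lia.
have FVP A : A \in F -> A \subset V /\ #|A| = a.
  by move/(subsetP FV); rewrite inE => /andP[-> /eqP].
have GVP A : A \in G -> A \subset V /\ #|A| = b.
  by move/(subsetP GV); rewrite inE => /andP[-> /eqP].
have mF A : A \in F -> meets A G by move=> AF B; apply: cFG.
have mG B : B \in G -> meets B F by move=> BG A AF; rewrite disjoint_sym cFG.
have [/existsP[w /andP[/forall_inP wF /forall_inP wG]]|] :=
    boolP [exists w, [forall (A | A \in F), w \in A] && [forall (A | A \in G), w \in A]].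
  exists w => //; have /card_gt0P[A AF] := F0.
  by apply: (subsetP (proj1 (FVP _ AF))); apply: wF.
rewrite negb_exists => /forallP N; exfalso.
(* One set missing [u], in either family, gives two such sets in the other family, and one of these
   gives two back in the first. *)
have miss u : 1 < #|[set A in F | u \notin A]| /\ 1 < #|[set B in G | u \notin B]|.
  have missG A : A \in F -> u \notin A -> 1 < #|[set B in G | u \notin B]|.
    move=> AF uA; have [AV cA] := FVP _ AF.
    exact: two_missed GV (ltnW b1) AV cA (mF _ AF) uA HG.
  have missF B : B \in G -> u \notin B -> 1 < #|[set A in F | u \notin A]|.
    move=> BG uB; have [BV cB] := GVP _ BG.
    exact: two_missed FV (ltnW a1) BV cB (mG _ BG) uB HF.
  have := N u; rewrite negb_and !negb_forall_in => /orP[] /exists_inP[A AX uA].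
    have H := missG _ AX uA; split=> //.
    by have /ltnW/card_gt0P[B] := H; rewrite inE => /andP[BG uB]; apply: missF BG uB.
  have H := missF _ AX uA; split=> //.
  by have /ltnW/card_gt0P[B] := H; rewrite inE => /andP[BF uB]; apply: missG BF uB.
have missF u : exists2 A, A \in F & u \notin A.
  by have [/ltnW/card_gt0P[A +] _] := miss u; rewrite inE => /andP[]; exists A.
have missG u : exists2 A, A \in G & u \notin A.
  by have [_ /ltnW/card_gt0P[A]] := miss u; rewrite inE => /andP[]; exists A.
pose P := heavy F (2 * a) 'C(#|V| - 2, a - 2).
pose Q := heavy G (2 * a) 'C(#|V| - 2, b - 2).
have n1 : 2 * a * a * b <= #|V| by lia.
have n2 : 2 * a * b * a <= #|V| by lia.
have a20 : 0 < 2 * a by lia.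
have mP e B : e \in P -> B \in G -> ~~ [disjoint B & e].
  move=> eP BG; have [_ cB] := GVP _ BG.
  by apply: (heavy_meets FV a1 (ltnW b1) a20 n1 _ (mG _ BG) eP); rewrite cB.
have mQ e A : e \in Q -> A \in F -> ~~ [disjoint A & e].
  move=> eP AF; have [_ cA] := FVP _ AF.
  by apply: (heavy_meets GV b1 (ltnW a1) a20 n2 _ (mF _ AF) eP); rewrite cA.
have mPG e : e \in P -> meets e G by move=> eP B BG; rewrite disjoint_sym mP.
have mQF e : e \in Q -> meets e F by move=> eQ A AF; rewrite disjoint_sym mQ.
have gP : graph P by apply: heavy_graph.
have gQ : graph Q by apply: heavy_graph.
have cPQ : cross P Q.
  move=> e f eP fQ; rewrite disjoint_sym.
  by apply: (heavy_meets FV a1 (ltnW b1) a20 n1 _ (mQF _ fQ) eP); rewrite gQ.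
have HF' : 'C(#|V|.-1, a.-1) < #|F| + 'C(#|V|.-1 - b, a.-1) by lia.
have HG' : 'C(#|V|.-1, b.-1) < #|G| + 'C(#|V|.-1 - a, b.-1) by lia.
have [P1 Pb] : 1 < #|P| /\ forall Q, graph Q -> 1 < #|Q| -> (forall q, q \in Q -> meets q F) ->
    b <= #|P|.
  apply: (heavy_large FV a1 _ n1 HF' _ missG G0); first by rewrite b1.
  by move=> B BG; have [_ cB] := GVP _ BG; split=> //; apply: mG.
have [Q1 Qa] : 1 < #|Q| /\ forall P, graph P -> 1 < #|P| -> (forall q, q \in P -> meets q G) ->
    a <= #|Q|.
  apply: (heavy_large GV b1 _ n2 HG' _ missF F0); first by rewrite a1 leqnn.
  by move=> B BG; have [_ cB] := FVP _ BG; split=> //; apply: mF.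
have {}Pb := Pb _ gQ Q1 mQF.
have {}Qa := Qa _ gP P1 mPG.
have nP : nonstar P.
  apply: (nonstar_of_missed gP Pb _ (fun u => proj2 (miss u))) => B BG.
  by have [_ cB] := GVP _ BG; split=> // e eP; apply: mP.
have nQ : nonstar Q.
  apply: (nonstar_of_missed gQ Qa _ (fun u => proj1 (miss u))) => A AF.
  by have [_ cA] := FVP _ AF; split=> // e eP; apply: mQ.
(* A family of 2-sets consists of heavy pairs, and the size hypothesis gives it at least [b + 2]
   members. *)
have a2P : a = 2 -> b.+2 <= #|P|.
  move=> Ea; move: FV HF; rewrite /P Ea !bin1 => FV2 HF2.
  apply: leq_trans (subset_leq_card (sub_heavy FV2 (isT : 1 < 2 * 2))); nia.
have b2Q : b = 2 -> a.+2 <= #|Q|.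
  move=> Eb; move: GV HG; rewrite /Q Eb !bin1 => GV2 HG2.
  have L : 1 < 2 * a by lia.
  by apply: leq_trans (subset_leq_card (sub_heavy GV2 L)); nia.
(* The first two outcomes force [a = b = 2], where both graphs have at least four edges. In the
   third [a] and [b] are at most 3, and [b2Q] excludes [b = 2]. *)
have [[P2 Q4]|Q2|[P3 Q3 [p1 [p2 [p3 [[h1 h2 h3 d2 d3] [n12 n13 cov]]]]]]] :=
  cross_nonstar gP gQ nP nQ cPQ (ltnW Q1); unfold reverse_coercion in *; try lia.
have [Ea Eb] : a = 3 /\ b = 3 by lia.
have FV3 := FV; have HF3 := HF; rewrite Ea in FV3; rewrite Ea Eb in HF3.
have := @card_three_pairs _ V F p1 p2 p3 FV3 (heavy_sub FV h1) (heavy_sub FV h2)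
  (heavy_sub FV h3) (gP _ h1) (gP _ h2) (gP _ h3) d2 d3 n12 n13.
have mFQ A : A \in F -> meets A Q by move=> AF e eQ; apply: mQ.
move=> /(_ (fun A AF => cov A (mFQ A AF))).
(* With $n=|V|$ we have $\binom{n-1}{2}-\binom{n-4}{2}=3n-9$, so the size hypothesis reads
   $|F|>3n-8$. *)
move: HF3; have : 4 <= #|V| by nia.
move: #|V| => n n4; have [m ->] : exists m, n = m.+4 by exists (n - 4); lia.
rewrite [3.-1]/= [m.+4.-1]/= !binS !bin1 !subSS subn0 !bin0.
unfold reverse_coercion; lia.
Qed.

End CrossStar.

(** * Induction on t *)

Section Stability.
Variable T : finType.
Implicit Types (V A B U W : {set T}) (F : nat -> {set {set T}}) (k : nat -> nat).

(** The subscripts $k_{3-i}$ for $i\le 2$ and $k_3$ beyond, which occur in the last binomial of the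
    size hypothesis. *)
Definition pad k i := if i == 1 then k 2 else if i == 2 then k 1 else k 3.

Definition large V t k F i :=
  'C(#|V|, k i) + 1 < #|F i| + 'C(#|V| - t, k i) + 'C(#|V| - t - pad k i, (k i).-1).

Lemma antitone_le t k i j : (forall i, 1 <= i <= t -> k i.+1 <= k i) ->
  1 <= i -> i <= j <= t.+1 -> k j <= k i.
Proof.
move=> mono i1; elim: j => [|j IH]; first by lia.
move=> Hj; have [->//|ij] := eqVneq i j.+1.
by apply: leq_trans (IH _); [apply: mono|]; lia.
Qed.

Lemma binSpred n (k : nat) : 0 < n -> 0 < k -> 'C(n, k) = 'C(n.-1, k) + 'C(n.-1, k.-1).
Proof. by case: n k => [|n] [|k] // _ _; rewrite binS. Qed.

Lemma rainbow2 F A B : A \in F 1 -> B \in F 2 -> [disjoint A & B] -> rainbow 2 F.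
Proof.
move=> AF BF dAB; exists (fun i => if i == 1 then A else B); split.
  by case=> [|[|[|i]]].
by case=> [|[|[|i]]] // [|[|[|j]]] //= _ _ _; rewrite disjoint_sym.
Qed.

(** Pascal's rule turns the size hypothesis for $t=1$ into that of [cross_star]. *)
Lemma stability_two V k F : 2 <= k 2 <= k 1 -> 2 * (k 1) ^ 2 * k 2 <= #|V| ->
  (forall i, 1 <= i <= 2 -> F i \subset draws V (k i) /\ large V 1 k F i) ->
  rainbow 2 F \/
  exists W, [/\ W \subset V, #|W| = 1 & forall i, 1 <= i <= 2 -> meets W (F i)].
Proof.
move=> /andP[k2 k21] Hn HF; have n0 : 0 < #|V| by nia.
have [[F1 L1] [F2 L2]] := (HF 1 isT, HF 2 isT).
have [/exists_inP[A AF /exists_inP[B BF dAB]]|N] :=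
    boolP [exists A in F 1, [exists B in F 2, [disjoint A & B]]].
  by left; apply: rainbow2 AF BF dAB.
have cF : cross (F 1) (F 2).
  move=> A B AF BF; apply: contra N => dAB.
  by apply/exists_inP; exists A => //; apply/exists_inP; exists B.
have [|||w wV [w1 w2]] := cross_star F1 F2 _ Hn cF.
- by rewrite k2.
- by move: L1; rewrite /large /pad /= (binSpred n0) ?subn1; lia.
- by move: L2; rewrite /large /pad /= (binSpred n0) ?subn1; lia.
right; exists [set w]; rewrite sub1set cards1; split=> // i Hi A AF.
rewrite disjoints1 negbK; have /orP[/eqP E|/eqP E] : (i == 1) || (i == 2) by lia.
- by apply: w1; rewrite -E.
- by apply: w2; rewrite -E.
Qed.

(** The absent sets meeting [W], the members of [G] and the [k]-subsets of [V :\: W] are pairwise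
    disjoint. *)
Lemma card_missing V W (G : {set {set T}}) (k : nat) : W \subset V -> G \subset draws V k ->
  meets W G ->
  #|[set B in draws V k | ~~ [disjoint W & B] && (B \notin G)]| + #|G| + 'C(#|V| - #|W|, k)
    <= 'C(#|V|, k).
Proof.
move=> WV GV mW; have -> : #|V| - #|W| = #|V :\: W| by rewrite cardsD (setIidPr WV).
set X := [set B in draws V k | _].
rewrite -!cards_draws -/(draws _ _) -/(draws (V :\: W) k).
have d1 : X :&: G = set0.
  by apply/setP => B; rewrite !inE; case: (B \in G); rewrite ?andbF.
have d2 : (X :|: G) :&: draws (V :\: W) k = set0.
  apply/setP => B; rewrite !inE subsetD; apply/negP.
  case/andP => /orP[/andP[_ /andP[dB _]]|BG] /andP[/andP[_ dB'] _].
    by rewrite disjoint_sym dB' in dB.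
  by have := mW _ BG; rewrite disjoint_sym dB'.
rewrite -(cardsUI X G) d1 cards0 addn0 -(cardsUI (X :|: G)) d2 cards0 addn0.
apply: subset_leq_card; rewrite !subUset GV /= andbT; apply/andP; split.
  by apply/subsetP => B; rewrite inE => /andP[].
by apply/subsetP => B; rewrite !inE subsetD => /andP[/andP[-> _] ->].
Qed.

Lemma stability t V k F : 0 < t -> (forall i, 1 <= i <= t -> k i.+1 <= k i) ->
  2 <= k t.+1 -> 2 * (k 1) ^ 2 * k 2 * t <= #|V| ->
  (forall i, 1 <= i <= t.+1 -> F i \subset draws V (k i) /\ large V t k F i) ->
  rainbow t.+1 F \/
  exists W, [/\ W \subset V, #|W| = t & forall i, 1 <= i <= t.+1 -> meets W (F i)].
Proof.
elim: t V F => // t IH V F _ mono kt Hn HF.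
have [t0|t0] := posnP t.
  subst t; rewrite muln1 in Hn; have k12 : 2 <= k 2 <= k 1 by rewrite mono // andbT.
  exact: stability_two k12 Hn HF.
set K := k 1; set s := t.+1 in mono kt Hn HF *.
have anti i j := @antitone_le s k i j mono.
have kK i : 1 <= i <= s.+1 -> 2 <= k i <= K.
  by move=> Hi; rewrite (leq_trans kt) ?anti //; lia.
have K2 : 2 <= K by case/andP: (kK 1 ltac:(lia)).
have nK i : 2 <= i <= s.+1 -> 2 * K ^ 2 * k i * s <= #|V|.
  move=> Hi; apply: leq_trans Hn; rewrite leq_mul2r leq_mul2l; apply/orP; right.
  by rewrite anti ?orbT //; lia.
have /andP[kl kl'] := kK s.+1 ltac:(lia).
have sV : s < #|V|.
  apply: leq_trans (nK 2 ltac:(lia)); rewrite ltn_Pmull //.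
  by have /andP[k2 _] := kK 2 ltac:(lia); nia.
have FV i : 1 <= i <= s.+1 -> F i \subset draws V (k i) by case/HF.
have cF i A : 1 <= i <= s.+1 -> A \in F i -> A \subset V /\ #|A| = k i.
  by move=> Hi /(subsetP (FV _ Hi)); rewrite inE => /andP[-> /eqP].
(* By Pascal's rule, as the last binomial of [large] is at most ['C(#|V| - s, (k i).-1)]. *)
have big i : 1 <= i <= s.+1 -> 'C(#|V|, k i) < #|F i| + 'C(#|V| - s.-1, k i).
  move=> Hi; have [_] := HF i Hi; have /andP[ki _] := kK i Hi; rewrite /large.
  rewrite (@binSpred (#|V| - s.-1)); [|lia|lia].
  have -> : (#|V| - s.-1).-1 = #|V| - s by lia.
  by have := leq_bin2l (k i).-1 (leq_subr (pad k i) (#|V| - s)); lia.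
pose N := 'C(#|V| - 2, k s.+1 - 2).
have [/existsP[v vd]|/existsPn Nv] :=
    boolP [exists v, s * K * N < #|[set A in F s.+1 | v \in A]|]; last first.
  left; apply: (@rainbow_extend _ _ _ K set0).
  - apply: (@rainbow_large _ _ V k _ K) => i Hi.
    + by split; [apply: kK|apply: FV]; lia.
    + by apply: nK; lia.
    + by apply: big; lia.
  - move=> i A Hi AF; have [_ ->] := cF i A ltac:(lia) AF.
    by rewrite disjoint_sym -setI_eq0 set0I; case/andP: (kK i ltac:(lia)).
  - move=> U UK _; apply: (@exists_disjoint _ _ _ (s * K * N)).
      by move=> u _; rewrite leqNgt.
    have K0 : 0 < K by lia.
    have := bin_greedy (ltac:(lia) : 1 < s) kl K0 (nK s.+1 ltac:(lia)); rewrite -/N => H1.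
    have H2 := big s.+1 ltac:(lia).
    apply: leq_ltn_trans (_ : (s * K) ^ 2 * N < _); last by lia.
    by rewrite mulnA leq_mul2r; apply/orP; right; rewrite -mulnn leq_mul2r UK orbT.
have vV : v \in V.
  move: vd; apply: contraLR => vV; rewrite -leqNgt (_ : [set _ in _ | _] = set0) ?cards0 //.
  apply/setP => A; rewrite !inE; apply/negP => /andP[AF vA].
  by have [/subsetP/(_ v vA) vV' _] := cF s.+1 A ltac:(lia) AF; rewrite vV' in vV.
pose F' i := [set A in F i | v \notin A].
have IHs : rainbow s F' \/
    exists W, [/\ W \subset V :\ v, #|W| = t & forall i, 1 <= i <= s -> meets W (F' i)].
  apply: (IH (V :\ v) F' t0).
  - by move=> i Hi; apply: mono; lia.
  - by case/andP: (kK t.+1 ltac:(lia)).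
  - rewrite cardD1_mem // -/K; have := nK 2 ltac:(lia); rewrite /s mulnS.
    by have /andP[? ?] := kK 2 ltac:(lia); nia.
  move=> i Hi; have Hi' : 1 <= i <= s.+1 by lia.
  split; first exact: draws_deleted (FV _ Hi').
  have [Fd] := HF i Hi'; have /andP[ki _] := kK i Hi'.
  (* As [#|V|] and [s] both drop by one, the two subtracted binomials do not change; Pascal's rule
     accounts for the sets through [v]. *)
  rewrite /large cardD1_mem //; have -> : #|V|.-1 - t = #|V| - s by lia.
  rewrite (@binSpred #|V|); [|lia|lia].
  have := @card_deleted _ V v (k i).-1 (F i) vV; rewrite prednK; last by lia.
  by move=> /(_ Fd); rewrite -/(F' i); unfold reverse_coercion; lia.
have sK i A : 1 <= i <= s.+1 -> A \in F i -> #|A| <= K.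
  by move=> Hi AF; have [_ ->] := cF i A Hi AF; case/andP: (kK i Hi).
have [R|[W [WV cW HW]]] := IHs.
  left; apply: (@rainbow_sub _ s.+1 (fun i => if i == s.+1 then F i else F' i)).
    by move=> i _; case: ifP => // _; apply/subsetP => A; rewrite inE => /andP[].
  apply: (@rainbow_extend _ _ _ K [set v]).
  - apply: rainbow_sub R => i Hi; case: eqP => //; lia.
  - move=> i A Hi; case: eqP => [|_]; first lia.
    rewrite inE => /andP[AF vA]; split; first by apply: (sK i) => //; lia.
    by rewrite disjoint_sym disjoints1.
  - move=> U UK; rewrite disjoint_sym disjoints1 => vU; rewrite eqxx.
    have [|||||A] := @exists_disjoint_star _ V [set A in F s.+1 | v \in A] U (k s.+1) v.
    + by apply: subset_trans (FV s.+1 _); [apply/subsetP => A; rewrite inE => /andP[]|lia].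
    + by move=> A; rewrite inE => /andP[].
    + by [].
    + by [].
    + by apply: leq_ltn_trans vd; rewrite leq_mul2r UK orbT.
    by rewrite inE => /andP[AF _] AU; exists A.
have vW : v \notin W by apply/negP => /(subsetP WV); rewrite !inE eqxx.
have WvV : v |: W \subset V by rewrite subUset sub1set vV (subset_trans WV (subD1set _ _)).
have cWv : #|v |: W| = s by rewrite cardsU1 vW cW.
have cov i : 1 <= i <= s -> meets (v |: W) (F i).
  move=> Hi A AF; rewrite disjointsU1 negb_and negbK.
  by have [//|vA] := boolP (v \in A); apply: (HW i Hi); rewrite inE AF.
have [/forall_inP all|/forall_inPn[A AF dA]] :=
    boolP [forall (A | A \in F s.+1), ~~ [disjoint v |: W & A]].
  right; exists (v |: W); split=> // i Hi.
  by have [->|ni] := eqVneq i s.+1; [exact: all|apply: cov; lia].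
rewrite negbK in dA; left.
have [AV cA] := cF s.+1 A ltac:(lia) AF.
have R : rainbow s (fun i => [set B in F i | (B \in draws V (k i)) && [disjoint B & A]]).
  apply: (@rainbow_star _ s V (v |: W) A k F K) => //.
  - by rewrite disjoint_sym.
  - by rewrite cA.
  - by move=> i Hi; apply: kK; lia.
  - by move=> i Hi; apply: nK; lia.
  move=> i Hi; have Hi' : 1 <= i <= s.+1 by lia.
  have [Fd] := HF i Hi'; have /andP[ki _] := kK i Hi'; rewrite /large => L.
  (* The last binomial of the hypothesis is used here: [A] comes from the family of smallest
     uniformity, whose index is at least 3, so [pad k i] bounds its size and too few sets are absent
     to block [rainbow_star]. *)
  have padA : #|A| <= pad k i.
    rewrite cA /pad; case: eqP => [_|i1]; first by apply: anti; lia.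
    by case: eqP => [_|i2]; apply: anti; lia.
  have {padA} := @leq_bin2l (#|V| - s - pad k i) (#|V| - s - #|A|) (k i).-1 ltac:(lia).
  have := card_missing WvV Fd (cov i Hi); rewrite cWv.
  by unfold reverse_coercion in *; lia.
(* The last family is cut down to [A] alone; the others already avoid [A], so the greedy step is
   immediate. *)
apply: (@rainbow_sub _ s.+1 (fun i => if i == s.+1 then [set A] else
    [set B in F i | (B \in draws V (k i)) && [disjoint B & A]])).
  move=> i Hi; case: eqP => [->|_]; first by rewrite sub1set.
  by apply/subsetP => B; rewrite inE => /andP[].
apply: (@rainbow_extend _ _ _ K A).
- by apply: rainbow_sub R => i Hi; case: eqP => //; lia.
- move=> i B Hi; case: eqP => [|_]; first lia.
  by rewrite !inE => /and3P[BF _ ->]; rewrite (sK i) //; lia.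
- by move=> U _ dU; exists A; rewrite ?eqxx ?inE // disjoint_sym.
Qed.
End Stability.

Lemma bound_large (n t k m f : nat) :
  (bound n t k m < f%:Z)%R -> 'C(n, k) + 1 < f + 'C(n - t, k) + 'C(n - t - m, k.-1).
Proof. by rewrite /bound; lia. Qed.

Theorem theorem1p2 (n t : nat) (k : nat -> nat) (F : nat -> {set {set 'I_n}}) :
  0 < n -> 0 < t ->
  (forall i, 1 <= i <= t -> k i.+1 <= k i) ->
  2 <= k t.+1 ->
  2 * (k 1) ^ 2 * k 2 * t <= n ->
  (forall i, 1 <= i <= t.+1 -> forall A, A \in F i -> #|A| = k i) ->
  (bound n t (k 1%N) (k 2%N) < (#|F 1%N|)%:Z)%R ->
  (bound n t (k 2%N) (k 1%N) < (#|F 2%N|)%:Z)%R ->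
  (forall i, 3 <= i <= t.+1 -> (bound n t (k i) (k 3%N) < (#|F i|)%:Z)%R) ->
  rainbow_matching t F \/
  exists W : {set 'I_n}, #|W| = t /\ forall i, 1 <= i <= t.+1 -> vertex_cover W (F i).
Proof.
move=> n0 t0 mono kt Hn cF H1 H2 H3.
have nV : #|[set: 'I_n]| = n by rewrite cardsT card_ord.
have [|i Hi|R|[W [_ cW HW]]] := @stability _ t [set: 'I_n] k F t0 mono kt.
- by rewrite nV.
- split; first by apply/subsetP => A AF; rewrite inE subsetT (cF _ Hi _ AF) eqxx.
  rewrite /large nV; apply: bound_large; rewrite /pad.
  case: eqP => [->//|i1]; case: eqP => [->//|i2]; apply: H3; lia.
- by left.
right; exists W; split=> // i Hi A AF.
by rewrite setI_eq0; apply: HW AF.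
Qed.
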